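(* Let $n$ be a positive integer. The graph $C_3 \times K_n$ admits a $C_4$-decomposition if and only if $n \equiv 0$ or $1 \pmod 4$.
   Context: $K_n$ is the complete graph on $n$ vertices, $C_k$ the cycle of length $k$. The tensor product $G \times H$ has vertex set $V(G)\times V(H)$, with $(g_1,h_1)$ adjacent to $(g_2,h_2)$ iff $g_1g_2 \in E(G)$ and $h_1h_2 \in E(H)$. A $C_k$-decomposition of a graph is a partition of its edge set into edge sets of subgraphs isomorphic to $C_k$. *)

(* Defs.v *)
From HB Require Import structures.
From mathcomp Require Import all_boot.

Set Implicit Arguments.
Unset Strict Implicit.
Unset Printing Implicit Defensive.

Record sgraph := SGraph {
  vertex :> finType;
  adj : rel vertex;
  adj_sym : symmetric adj;
  adj_irrefl : irreflexive adj }.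

Definition edges (G : sgraph) : {set {set G}} :=
  [set e : {set G} | [exists x, exists y, adj x y && (e == [set x; y])]].

Definition isomorphic (G H : sgraph) : Prop :=
  exists2 f : G -> H, bijective f & {mono f : x y / adj x y}.

Record subgraph (G : sgraph) := Subgraph {
  sub_vertices : {set G};
  sub_edges : {set {set G}};
  sub_edgesP : sub_edges \subset edges G;
  sub_coverP : cover sub_edges \subset sub_vertices }.

Section SubgraphGraph.
Variables (G : sgraph) (S : subgraph G).

Definition sub_adj : rel {x : G | x \in sub_vertices S} :=
  fun x y => [set val x; val y] \in sub_edges S.

Fact sub_adj_sym : symmetric sub_adj.
Proof. by move=> x y; rewrite /sub_adj setUC. Qed.

Fact sub_adj_irrefl : irreflexive sub_adj.
Proof.
move=> x; rewrite /sub_adj setUid; apply/negP => xS.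
have := subsetP (sub_edgesP S) _ xS.
rewrite inE => /existsP[u /existsP[v /andP[uv /eqP xuv]]].
have /set1P ux : u \in [set val x] by rewrite xuv set21.
have /set1P vx : v \in [set val x] by rewrite xuv set22.
by rewrite ux vx adj_irrefl in uv.
Qed.

Definition graph_of_subgraph : sgraph := SGraph sub_adj_sym sub_adj_irrefl.

End SubgraphGraph.

Coercion graph_of_subgraph : subgraph >-> sgraph.

Definition decomposition (H G : sgraph) (P : {set {set {set G}}}) : Prop :=
  partition P (edges G) /\
  forall F, F \in P -> exists2 S : subgraph G, isomorphic S H & sub_edges S = F.

Definition admits_decomposition (H G : sgraph) : Prop :=
  exists P : {set {set {set G}}}, decomposition H P.

Section CompleteGraph.
Variable n : nat.

Definition complete_adj : rel 'I_n := fun i j => i != j.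

Fact complete_adj_sym : symmetric complete_adj.
Proof. by move=> i j; rewrite /complete_adj eq_sym. Qed.

Fact complete_adj_irrefl : irreflexive complete_adj.
Proof. by move=> i; rewrite /complete_adj eqxx. Qed.

Definition complete_graph : sgraph :=
  SGraph complete_adj_sym complete_adj_irrefl.

End CompleteGraph.

Section CycleGraph.
Variable k : nat.

(* [ordS i] is i + 1 modulo k.  The conjunct [i != j] matters only for k = 1;
   this is the cycle of length k when 2 < k. *)
Definition cycle_adj : rel 'I_k :=
  fun i j => (i != j) && ((j == ordS i) || (i == ordS j)).

Fact cycle_adj_sym : symmetric cycle_adj.
Proof. by move=> i j; rewrite /cycle_adj eq_sym orbC. Qed.

Fact cycle_adj_irrefl : irreflexive cycle_adj.
Proof. by move=> i; rewrite /cycle_adj eqxx. Qed.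

Definition cycle_graph : sgraph := SGraph cycle_adj_sym cycle_adj_irrefl.

End CycleGraph.

Section TensorProduct.
Variables G H : sgraph.

Definition tensor_adj : rel (G * H) :=
  fun p q => adj p.1 q.1 && adj p.2 q.2.

Fact tensor_adj_sym : symmetric tensor_adj.
Proof.
by move=> p q; rewrite /tensor_adj (adj_sym p.1) (adj_sym p.2).
Qed.

Fact tensor_adj_irrefl : irreflexive tensor_adj.
Proof. by move=> p; rewrite /tensor_adj adj_irrefl. Qed.

Definition tensor_product : sgraph := SGraph tensor_adj_sym tensor_adj_irrefl.

End TensorProduct.

(* Main.v *)
(** Necessity: the graph has [3 n (n - 1)] edges, so 4 divides [n (n - 1)].

    Sufficiency: write [n = m] or [n = m + 1] and identify the first [m] columns
    with the integers modulo [m].  An edge from [(p, s)] to [(p + 1, t)] has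
    difference [t - s], and four consecutive differences [d, ..., d + 3] between
    the parts [p] and [p + 1] are used up by the [m] translates of one 4-cycle.
    If [n = 4 k + 1], take [m = n]: the differences 1, ..., 4 k split into [k]
    such runs.  If [n = 4 k + 4], take [m = n - 1 = 4 k + 3], the last column
    being a point at infinity: the runs exhaust the differences 2, ..., m - 2,
    while [1], [-1] and the edges at infinity are covered by the translates of
    the cycle (p, infinity), (p + 1, x), (p, x + 1), (p + 2, x). *)

Require Import Defs.
From HB Require Import structures.
From mathcomp Require Import all_boot.
From mathcomp Require Import zify.

Set Implicit Arguments.
Unset Strict Implicit.
Unset Printing Implicit Defensive.

(** * Edges as unordered pairs, and edge counts through ordered pairs *)

Lemma eq_set2 (T : finType) (a b x y : T) :
  ([set a; b] == [set x; y]) = (a == x) && (b == y) || (a == y) && (b == x).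
Proof.
apply/eqP/orP => [E | [] /andP[/eqP-> /eqP->] //]; last by rewrite setUC.
have: a \in [set x; y] by rewrite -E set21.
have: b \in [set x; y] by rewrite -E set22.
have: x \in [set a; b] by rewrite E set21.
have: y \in [set a; b] by rewrite E set22.
rewrite !inE (eq_sym x a) (eq_sym x b) (eq_sym y a) (eq_sym y b).
by case: (a == x); case: (b == y); case: (a == y); case: (b == x); auto.
Qed.

Lemma mem_edges (G : sgraph) (x y : G) : ([set x; y] \in edges G) = adj x y.
Proof.
rewrite inE; apply/existsP/idP => [[u /existsP[v /andP[uv]]] | xy].
  by rewrite eq_set2 => /orP[] /andP[/eqP-> /eqP->] //; rewrite adj_sym.
by exists x; apply/existsP; exists y; rewrite xy eqxx.
Qed.

Lemma edgesP (G : sgraph) (e : {set G}) :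
  reflect (exists x, exists2 y, adj x y & e = [set x; y]) (e \in edges G).
Proof.
apply: (iffP idP) => [|[x [y xy ->]]]; last by rewrite mem_edges.
rewrite inE => /existsP[x /existsP[y /andP[xy /eqP->]]].
by exists x, y.
Qed.

(** Ordered pairs make counting multiplicative over tensor products, whereas one edge from each
    factor gives two edges of the product. *)
Definition arcs (G : sgraph) : {set G * G} := [set p | adj p.1 p.2].

(** Each edge has two preimages under [p |-> [set p.1; p.2]], distinct because there are no loops.
    Allowing any [E] lets the count apply to subgraphs too. *)
Lemma card_edge_arcs (G : sgraph) (E : {set {set G}}) : E \subset edges G ->
  #|[set p : G * G | [set p.1; p.2] \in E]| = 2 * #|E|.
Proof.
move=> /subsetP sE; rewrite -sum1_card.
rewrite (partition_big (fun p : G * G => [set p.1; p.2]) (mem E)); last first.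
  by move=> p; rewrite inE.
rewrite mulnC -sum_nat_const; apply: eq_bigr => e eE.
have /edgesP[x [y xy e_xy]] := sE e eE.
have neq_xy : x != y by apply: contraTneq xy => ->; rewrite adj_irrefl.
rewrite sum1dep_card (_ : [set _ | _] = [set (x, y); (y, x)]).
  by rewrite cards2 xpair_eqE (negPf neq_xy).
apply/setP => -[a b]; rewrite !inE /= e_xy eq_set2 !xpair_eqE.
apply: andb_idl => ab; suff -> : [set a; b] = e by [].
by apply/eqP; rewrite e_xy eq_set2.
Qed.

Lemma card_arcs (G : sgraph) : #|arcs G| = 2 * #|edges G|.
Proof.
by rewrite -card_edge_arcs //; apply: eq_card => p; rewrite !inE -mem_edges inE.
Qed.

Lemma card_arcs_sum (G : sgraph) :
  #|arcs G| = \sum_(x : G) #|[set y | adj x y]|.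
Proof.
rewrite -sum1dep_card.
rewrite -(pair_big_dep xpredT (fun x y : G => adj x y) (fun _ _ => 1)).
by apply: eq_bigr => x _; rewrite sum1dep_card.
Qed.

Lemma card_arcs_isomorphic (G H : sgraph) :
  isomorphic G H -> #|arcs G| = #|arcs H|.
Proof.
case=> f [g fK gK] f_adj.
pose F (p : G * G) : H * H := (f p.1, f p.2).
have F_inj : injective F by move=> [a b] [x y] [] /(can_inj fK)-> /(can_inj fK)->.
rewrite -(card_imset _ F_inj); apply: eq_card => -[x y].
apply/imsetP/idP => [[[a b]] | xy]; first by rewrite !inE -f_adj => ? [-> ->].
by exists (g x, g y); rewrite /F /= ?gK // inE -f_adj !gK; rewrite inE in xy.
Qed.

(** Arcs of [S] live on a subtype and embed by [val]; conversely [sub_coverP] puts both ends of an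
    edge back in the subtype. *)
Lemma card_arcs_subgraph (G : sgraph) (S : subgraph G) :
  #|arcs S| = 2 * #|sub_edges S|.
Proof.
rewrite -card_edge_arcs ?sub_edgesP //.
pose f (p : S * S) : G * G := (val p.1, val p.2).
have f_inj : injective f by move=> [a b] [c d] [] /val_inj-> /val_inj->.
rewrite -(card_imset _ f_inj); apply: eq_card => -[x y].
rewrite inE; apply/imsetP/idP => [[[a b]] | /= xyE].
  by rewrite inE /= => ab [-> ->].
have sV z : z \in [set x; y] -> z \in sub_vertices S.
  by move=> zxy; apply: (subsetP (sub_coverP S)); apply/bigcupP; exists [set x; y].
exists (Sub x (sV x (set21 _ _)), Sub y (sV y (set22 _ _))) => //.
by rewrite inE.
Qed.

Lemma card_arcs_tensor (G H : sgraph) :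
  #|arcs (tensor_product G H)| = #|arcs G| * #|arcs H|.
Proof.
rewrite -cardsX.
pose f (p : (G * H) * (G * H)) := ((p.1.1, p.2.1), (p.1.2, p.2.2)).
have f_inj : injective f by move=> [[a b] [c d]] [[x y] [z t]] [-> -> -> ->].
rewrite -(card_imset _ f_inj); apply: eq_card => -[[a c] [b d]].
apply/imsetP/idP => [[[[x y] [z t]]] | ].
  by rewrite !inE => /andP[/= xz yt] [-> -> -> ->]; rewrite xz yt.
by rewrite !inE /= => abcd; exists ((a, b), (c, d)); rewrite ?inE.
Qed.

Lemma card_arcs_complete n : #|arcs (complete_graph n)| = n * n.-1.
Proof.
rewrite card_arcs_sum -[n in n * _]card_ord -sum_nat_const; apply: eq_bigr => i _.
rewrite -[n in n.-1]card_ord -(cardsC1 i); apply: eq_card => j.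
by rewrite !inE eq_sym.
Qed.

Lemma ordS_neq k (i : 'I_k) : 1 < k -> ordS i != i.
Proof.
move=> k_gt1; rewrite -val_eqE /=; have := ltn_ord i.
rewrite leq_eqVlt => /orP[/eqP i_max | lt_i]; last by rewrite modn_small //; lia.
by rewrite i_max modnn; lia.
Qed.

Lemma ordS_ordS_neq k (i : 'I_k) : 2 < k -> ordS (ordS i) != i.
Proof.
move=> k_gt2; rewrite -val_eqE /= -addn1 modnDml addn1.
have [lt_i | ge_i] := ltnP i.+2 k; first by rewrite modn_small //; lia.
have -> : i.+2 = i.+2 - k + k by lia.
by rewrite modnDr modn_small; have := ltn_ord i; lia.
Qed.

(** Every vertex has degree 2: its successor and predecessor differ as soon as [2 < k]. *)
Lemma card_arcs_cycle k : 2 < k -> #|arcs (cycle_graph k)| = 2 * k.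
Proof.
move=> k_gt2; rewrite card_arcs_sum mulnC -[in RHS](card_ord k) -sum_nat_const.
apply: eq_bigr => i _.
have pred_neq : ordS i != ord_pred i.
  by rewrite -(inj_eq (@ordS_inj k)) ord_predK ordS_ordS_neq.
rewrite (_ : [set _ | _] = [set ordS i; ord_pred i]).
  by rewrite cards2 pred_neq.
apply/setP => j; rewrite !inE /= /cycle_adj (eq_sym i (ordS j)) (canF_eq (@ordSK k)).
rewrite andb_idl // => /orP[] /eqP ->.
  by rewrite eq_sym ordS_neq // ltnW.
by rewrite -(inj_eq (@ordS_inj k)) ord_predK ordS_neq // ltnW.
Qed.

(** * Criteria for decompositions: covering families of cycles, and divisibility *)

(* By the last hypothesis a family covering all edges covers each exactly once. *)
Lemma cycle_family_decomposition (k : nat) (G : sgraph) (I : finType)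
    (c : I -> 'I_k -> G) :
    0 < k -> (forall i, injective (c i)) ->
    (forall i l, adj (c i l) (c i (ordS l))) ->
    (forall x y, adj x y -> exists i l, [set x; y] = [set c i l; c i (ordS l)]) ->
    #|I| * k <= #|edges G| ->
  admits_decomposition (cycle_graph k) G.
Proof.
move=> k_gt0 c_inj c_adj c_cover cardI.
pose E i := [set [set c i l; c i (ordS l)] | l : 'I_k].
have E_edges i : E i \subset edges G.
  by apply/subsetP => _ /imsetP[l _ ->]; rewrite mem_edges.
exists [set E i | i : I]; split; last first.
  move=> _ /imsetP[i _ ->].
  have E_cover : cover (E i) \subset [set c i l | l : 'I_k].
    apply/bigcupsP => _ /imsetP[l _ ->].
    by apply/subsetP => z /set2P[] ->; apply: imset_f.
  exists (Subgraph (E_edges i) E_cover) => //; set S := Subgraph _ _.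
  pose g l : S := exist _ (c i l) (imset_f (c i) (isT : l \in 'I_k)).
  have g_inj : injective g by move=> l l' [/c_inj].
  (* [g] parametrises the vertices of the block; choosing a parameter for each vertex inverts it. *)
  have gP (x : S) : exists l, x == g l.
    by have /imsetP[l _ xl] := valP x; exists l; apply/eqP/val_inj.
  pose f x := xchoose (gP x).
  have fK : cancel f g by move=> x; rewrite /f -(eqP (xchooseP (gP x))).
  have gK : cancel g f by move=> l; apply: g_inj; rewrite fK.
  exists f; first by exists g.
  move=> x y; rewrite -[in RHS](fK x) -[in RHS](fK y).
  move: (f x) (f y) => l l'; rewrite /= /sub_adj /= /cycle_adj.
  apply/idP/imsetP => [/andP[_ /orP[] /eqP ->] | [m _ /eqP]].
  - by exists l.
  - by exists l'; rewrite // setUC.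
  (* A fixed point of [ordS] would turn [c_adj] into a loop, which gives the inequality required by
     [cycle_adj]. *)
  rewrite eq_set2 !(inj_eq (c_inj i)) => /orP[] /andP[/eqP-> /eqP->].
    rewrite eqxx andbT; apply: contraTneq (c_adj i m) => <-.
    by rewrite adj_irrefl.
  rewrite eqxx orbT andbT; apply: contraTneq (c_adj i m) => ->.
  by rewrite adj_irrefl.
have coverE : cover [set E i | i : I] = edges G.
  apply/eqP; rewrite eqEsubset; apply/andP; split.
    by apply/bigcupsP => _ /imsetP[i _ ->].
  apply/subsetP => _ /edgesP[x [y xy ->]].
  have [i [l ->]] := c_cover x y xy; apply/bigcupP.
  by exists (E i); apply: imset_f.
apply/and3P; split; first by rewrite coverE.
  (* The number of edges is at most the sum of the block sizes, which is at most [#|I| * k], hence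
     at most the number of edges. Equality in [leq_card_cover] is disjointness. *)
  have := leq_card_cover [set E i | i : I]; rewrite coverE.
  case=> le_cover <-; rewrite eqn_leq le_cover /=.
  apply: leq_trans cardI.
  apply: (@leq_trans (#|[set E i | i : I]| * k)).
    rewrite -sum_nat_const; apply: leq_sum => _ /imsetP[i _ ->].
    by apply: leq_trans (leq_imset_card _ _) _; rewrite card_ord.
  by rewrite leq_mul2r leq_imset_card orbT.
apply/negP => /imsetP[i _ E0]; pose l0 := Ordinal k_gt0.
have: [set c i l0; c i (ordS l0)] \in E i by apply/imsetP; exists l0.
by rewrite -E0 in_set0.
Qed.

(** All blocks have the size of [H]. Sizes are compared through arcs, since an isomorphism acts on
    vertices. *)
Lemma decomposition_dvdn (H G : sgraph) :
  admits_decomposition H G -> #|edges H| %| #|edges G|.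
Proof.
case=> P [P_part PH]; rewrite (@card_uniform_partition _ #|edges H| P) ?dvdn_mull //.
move=> F /PH[S S_iso <-]; apply/eqP; rewrite -(eqn_pmul2l (isT : 0 < 2)).
by rewrite -card_arcs_subgraph -card_arcs (card_arcs_isomorphic S_iso).
Qed.

(** [ucycle] packs distinctness and adjacency into one boolean that unfolds on explicit 4-tuples. *)
Lemma C4_family_decomposition (G : sgraph) (I : finType) (c : I -> 4.-tuple G) :
    (forall i, ucycle (@adj G) (c i)) ->
    (forall x y, adj x y -> exists i,
       [exists l : 'I_4, [set x; y] == [set tnth (c i) l; tnth (c i) (ordS l)]]) ->
    #|I| * 4 <= #|edges G| ->
  admits_decomposition (cycle_graph 4) G.
Proof.
move=> c_cycle c_cover.
apply: (cycle_family_decomposition (c := fun i => tnth (c i))) => //.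
- by move=> i; apply/tuple_uniqP; have /andP[] := c_cycle i.
- move=> i l; have /andP[] := c_cycle i.
  case: (c i) => -[|x0 [|x1 [|x2 [|x3 [|//]]]]] // sz /= /and5P[? ? ? ? _] _.
  by case: l => [[|[|[|[|//]]]] lt_l]; rewrite !(tnth_nth x0).
- by move=> x y /c_cover[i /existsP[l /eqP]]; exists i, l.
Qed.

Lemma exists_modn_add m u v : u < m -> v < m -> exists2 d, d < m & v = (u + d) %% m.
Proof.
move=> lt_u lt_v; have [le_uv | lt_vu] := leqP u v.
  by exists (v - u); rewrite ?subnKC ?modn_small //; lia.
exists (v + m - u); first by lia.
by rewrite (_ : u + _ = v + m) ?modnDr ?modn_small //; lia.
Qed.

(** * The base 4-cycles, their translates and the edges they cover *)

Section Construction.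

Local Arguments adj : simpl never.

Variable N : nat.
Notation V := ('I_3 * 'I_N.+1)%type.
Notation T := (tensor_product (cycle_graph 3) (complete_graph N.+1)).

(** With [inord], columns are plain natural numbers open to arithmetic modulo [m]. It is faithful
    only up to [N], hence the bounds carried below. *)
Definition pt (p : 'I_3) (t : nat) : V := (p, inord t).

Lemma ptP (z : T) : exists p t, t <= N /\ z = pt p t.
Proof. by case: z => p t; exists p, t; rewrite /pt inord_val -ltnS. Qed.

Lemma eq_pt p q s t : s <= N -> t <= N -> (pt p s == pt q t) = (p == q) && (s == t).
Proof. by move=> ? ?; rewrite xpair_eqE -[inord s == _]val_eqE /= !inordK. Qed.

Lemma adj_pt p q s t : s <= N -> t <= N ->
  adj (pt p s : T) (pt q t) = (p != q) && (s != t).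
Proof.
move=> s_le t_le; rewrite /adj /= /tensor_adj /adj /= /complete_adj.
rewrite -[inord s == _]val_eqE /= !inordK //; congr (_ && _).
by case: p q => [[|[|[|//]]] ?] [[|[|[|//]]] ?].
Qed.

(* The differences along this cycle are d, d + 1, d + 3 and d + 2. *)
Definition bipartite_cycle m (p : 'I_3) x d : 4.-tuple T :=
  [tuple pt p (x.+1 %% m); pt (ordS p) ((x + d.+1) %% m);
         pt p (x %% m); pt (ordS p) ((x + d.+3) %% m)].

(* Column [m] plays the role of infinity. *)
Definition infinity_cycle m (p : 'I_3) x : 4.-tuple T :=
  [tuple pt p m; pt (ordS p) (x %% m); pt p (x.+1 %% m); pt (ordS (ordS p)) (x %% m)].

(** Two distinct vertices of a triangle are consecutive in one of the two orders, so every edge can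
    be read from a part to the next one. *)
Lemma adj_ordS_pt (x y : T) : adj x y ->
  exists p s t, [/\ s <= N, t <= N, s != t & [set x; y] = [set pt p s; pt (ordS p) t]].
Proof.
have [p [s [s_le ->]]] := ptP x; have [q [t [t_le ->]]] := ptP y.
rewrite adj_pt // => /andP[pq st].
have : (q == ordS p) || (p == ordS q).
  by move: pq; case: p q => [[|[|[|//]]] ?] [[|[|[|//]]] ?].
case/orP => /eqP ->; first by exists p, s, t.
by exists q, t, s; rewrite eq_sym setUC.
Qed.

Lemma ordS_ordS_ordS (p : 'I_3) : ordS (ordS (ordS p)) = p.
Proof. by apply/val_inj; case: p => [[|[|[|//]]] ?]. Qed.

Lemma ucycle_bipartite m p x d : m <= N.+1 -> 0 < d -> d.+3 < m ->
  ucycle (@adj T) (bipartite_cycle m p x d).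
Proof.
move=> le_m d_gt0 lt_d; have m_gt0 : 0 < m by lia.
have leN t : t %% m <= N by rewrite -ltnS (leq_trans (ltn_pmod _ _)).
have p0 : ordS p != p by rewrite ordS_neq.
have neq_mod a b : a < m -> b < m -> (x + a == x + b %[mod m]) = (a == b).
  by move=> ? ?; rewrite eqn_modDl !modn_small.
rewrite /ucycle /= !adj_pt ?inE ?negb_or ?eq_pt // eqxx p0 (eq_sym p) p0 /=.
(* All columns become [x + a] with offset [a] among 0, 1, [d + 1], [d + 3], all below [m]; only the
   offsets remain to be compared. *)
have x0 : x %% m = (x + 0) %% m by rewrite addn0.
by rewrite -[x.+1]addn1 x0 !neq_mod; lia.
Qed.

Lemma ucycle_infinity m p x : m <= N -> 1 < m -> ucycle (@adj T) (infinity_cycle m p x).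
Proof.
move=> le_m m_gt1; have m_gt0 : 0 < m by lia.
have ltm t : t %% m < m by rewrite ltn_pmod.
have leN t : t %% m <= N by rewrite ltnW // (leq_trans (ltm t)).
have neqm t : (t %% m == m) = false by rewrite ltn_eqF.
have p0 : ordS p != p by rewrite ordS_neq.
have p1 : ordS (ordS p) != ordS p by rewrite ordS_neq.
have p2 : ordS (ordS p) != p by rewrite ordS_ordS_neq.
have neq_mod : (x.+1 == x %[mod m]) = false.
  by rewrite -{2}[x]addn0 -addn1 eqn_modDl !modn_small.
rewrite /ucycle /= !adj_pt ?inE ?negb_or ?eq_pt // ?neqm ?(eq_sym m) ?neqm.
rewrite ?(eq_sym p (ordS p)) ?(eq_sym p (ordS (ordS p))).
rewrite ?(eq_sym (ordS p) (ordS (ordS p))).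
by rewrite ?(eq_sym (x %% m)) neq_mod (negPf p0) (negPf p1) (negPf p2) ?andbF.
Qed.

Definition covers (c : 4.-tuple T) (e : {set T}) :=
  [exists l : 'I_4, e == [set tnth c l; tnth c (ordS l)]].

Lemma covers_tuple (a b c d : T) (e : {set T}) :
  covers [tuple a; b; c; d] e =
  (e \in [:: [set a; b]; [set b; c]; [set c; d]; [set d; a]]).
Proof.
rewrite /covers; apply/existsP/idP => [[l] | ].
  rewrite !(tnth_nth a) !inE.
  by case: l => [[|[|[|[|//]]]] ?] /= ->; rewrite ?orbT.
rewrite !inE => /or4P[] e_l;
  [ exists (@Ordinal 4 0 isT) | exists (@Ordinal 4 1 isT)
  | exists (@Ordinal 4 2 isT) | exists (@Ordinal 4 3 isT)];
  by rewrite !(tnth_nth a).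
Qed.

(** The edges of difference [d] and [d + 2] leave column [x + 1] of part [p], those of difference
    [d + 1] and [d + 3] leave column [x]. So the translate is by the predecessor of [s] or by [s]
    itself. *)
Lemma bipartite_cycle_covers m p s t d e :
    s < m -> t = (s + e) %% m -> d <= e < d.+4 ->
  exists x : 'I_m,
    covers (bipartite_cycle m p x d) [set pt p s; pt (ordS p) t].
Proof.
move=> lt_s -> d_e.
have [x lt_x s_x] : exists2 x, x < m & x.+1 %% m = s.
  (* Adding [m.-1] is subtracting 1 modulo [m], without truncation at [s = 0]. *)
  exists ((s + m.-1) %% m); first by rewrite ltn_pmod //; lia.
  rewrite -addn1 modnDml (_ : _ + 1 = s + m); last by lia.
  by rewrite modnDr modn_small.
have s_xE a : (s + a) %% m = (x + a.+1) %% m.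
  by rewrite -s_x modnDml addSnnS.
have s_id : s = s %% m by rewrite modn_small.
have : [|| e == d, e == d.+1, e == d.+2 | e == d.+3] by lia.
case/or4P => /eqP ->; [exists (Ordinal lt_x) | exists (Ordinal lt_s)
  | exists (Ordinal lt_x) | exists (Ordinal lt_s)];
  by rewrite covers_tuple !inE !eq_set2 /= ?s_x !s_xE ?(modn_small lt_s) !eqxx ?orbT.
Qed.

(** Infinity in part [p] is met by the first edge of a cycle based at [p]; infinity in part [ordS p]
    by the last edge of one based at [ordS p], whose second successor is [p]. *)
Lemma infinity_cycle_covers_infinity m p s t :
    s <= m -> t <= m -> s != t -> (s == m) || (t == m) ->
  exists q (x : 'I_m),
    covers (infinity_cycle m q x) [set pt p s; pt (ordS p) t].
Proof.
move=> s_le t_le st /orP[/eqP s_m | /eqP t_m].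
  have lt_t : t < m by lia.
  by exists p, (Ordinal lt_t); rewrite covers_tuple inE /= modn_small // s_m eqxx.
have lt_s : s < m by lia.
exists (ordS p), (Ordinal lt_s).
by rewrite covers_tuple !inE /= ordS_ordS_ordS modn_small // t_m eqxx !orbT.
Qed.

(** Difference 1 is the third edge of a cycle based at [ordS p], difference -1 the second edge of
    one based at [p]. *)
Lemma infinity_cycle_covers_succ m p s t :
    s < m -> t < m -> (t == s.+1 %% m) || (s == t.+1 %% m) ->
  exists q (x : 'I_m),
    covers (infinity_cycle m q x) [set pt p s; pt (ordS p) t].
Proof.
move=> lt_s lt_t /orP[/eqP -> | /eqP ->].
  exists (ordS p), (Ordinal lt_s); rewrite covers_tuple !inE !eq_set2 /=.
  by rewrite ordS_ordS_ordS (modn_small lt_s) !eqxx !orbT.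
exists p, (Ordinal lt_t); rewrite covers_tuple !inE !eq_set2 /=.
by rewrite (modn_small lt_t) !eqxx !orbT.
Qed.

End Construction.

(** * The edge count, the two residue classes and the equivalence *)

Lemma card_edges_C3_Kn n :
  #|edges (tensor_product (cycle_graph 3) (complete_graph n))| = 3 * (n * n.-1).
Proof.
apply/eqP; rewrite -(eqn_pmul2l (isT : 0 < 2)) -card_arcs card_arcs_tensor.
by rewrite card_arcs_cycle // card_arcs_complete (mulnA 2 3).
Qed.

Lemma C3_Kn_decomposition_mod1 k :
  admits_decomposition (cycle_graph 4)
    (tensor_product (cycle_graph 3) (complete_graph (4 * k).+1)).
Proof.
pose c (i : 'I_3 * 'I_k * 'I_(4 * k).+1) :=
  bipartite_cycle (4 * k) (4 * k).+1 i.1.1 i.2 (4 * i.1.2).+1.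
apply: (C4_family_decomposition (c := c)) => [[[p j] x] | x y xy |].
- by apply: ucycle_bipartite => //=; have := ltn_ord j; lia.
- have [p [s [t [s_le t_le st ->]]]] := adj_ordS_pt xy.
  have [d lt_d t_d] := exists_modn_add (s_le : s < (4 * k).+1) (t_le : t < (4 * k).+1).
  have d_gt0 : 0 < d.
    by rewrite lt0n; apply: contraNneq st => d0; rewrite t_d d0 addn0 modn_small.
  (* Run [j] consists of the differences [4 * j + 1] to [4 * j + 4], so [d] lies in run
     [d.-1 %/ 4]. *)
  have lt_j : d.-1 %/ 4 < k by lia.
  have [|x' x'P] := @bipartite_cycle_covers (4 * k) (4 * k).+1 p s t
    (4 * (d.-1 %/ 4)).+1 d s_le t_d.
    by lia.
  by exists (p, Ordinal lt_j, x').
- by rewrite card_edges_C3_Kn !card_prod !card_ord /=; lia.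
Qed.

Lemma C3_Kn_decomposition_mod0 k :
  admits_decomposition (cycle_graph 4)
    (tensor_product (cycle_graph 3) (complete_graph (4 * k).+4)).
Proof.
pose m := (4 * k).+3.
(* [None] indexes the cycles through infinity, and [Some j] the run of differences starting at
   [4 * j + 2]. *)
pose c (i : 'I_3 * option 'I_k * 'I_m) :=
  if i.1.2 is Some j then bipartite_cycle m m i.1.1 i.2 (4 * j).+2
  else infinity_cycle m m i.1.1 i.2.
apply: (C4_family_decomposition (c := c)) => [[[p [j|]] x] | x y xy |].
- by apply: ucycle_bipartite => //=; have := ltn_ord j; lia.
- exact: ucycle_infinity.
- have [p [s [t [s_le t_le st ->]]]] := adj_ordS_pt xy.
  have [st_inf | ] := boolP ((s == m) || (t == m)).
    have [q [x' x'P]] := infinity_cycle_covers_infinity m p s_le t_le st st_inf.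
    by exists (q, None, x').
  rewrite negb_or => /andP[s_m t_m].
  have lt_s : s < m by rewrite ltn_neqAle s_m.
  have lt_t : t < m by rewrite ltn_neqAle t_m.
  have [d lt_d t_d] := exists_modn_add lt_s lt_t.
  have d_gt0 : 0 < d.
    by rewrite lt0n; apply: contraNneq st => d0; rewrite t_d d0 addn0 modn_small.
  have [st_succ | ] := boolP ((t == s.+1 %% m) || (s == t.+1 %% m)).
    have [q [x' x'P]] := infinity_cycle_covers_succ m p lt_s lt_t st_succ.
    by exists (q, None, x').
  rewrite negb_or => /andP[ts st'].
  have d1 : d != 1 by apply: contraNneq ts => d1; rewrite t_d d1 addn1.
  have dm : d != m.-1.
    apply: contraNneq st' => dm; rewrite t_d dm -addn1 modnDml -addnA addn1.
    by rewrite modnDr modn_small.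
  (* With 0, 1 and [m.-1] excluded, [d] lies between 2 and [m - 2 = 4 * k + 1], which is exactly [k]
     runs of four. *)
  have lt_j : (d - 2) %/ 4 < k by lia.
  have [|x' x'P] := @bipartite_cycle_covers m m p s t (4 * ((d - 2) %/ 4)).+2 d lt_s t_d.
    by lia.
  by exists (p, Some (Ordinal lt_j), x').
- by rewrite card_edges_C3_Kn !card_prod card_option !card_ord /=; lia.
Qed.

Theorem theorem3p3 (n : nat) (n_gt0 : 0 < n) :
  admits_decomposition (cycle_graph 4)
    (tensor_product (cycle_graph 3) (complete_graph n)) <->
  n = 0 %[mod 4] \/ n = 1 %[mod 4].
Proof.
split=> [/decomposition_dvdn | n_mod].
  rewrite card_edges_C3_Kn.
  have -> : #|edges (cycle_graph 4)| = 4.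
    by apply/eqP; rewrite -(eqn_pmul2l (isT : 0 < 2)) -card_arcs card_arcs_cycle.
  (* The factor 3 is coprime to 4, so 4 divides [n * n.-1]; the residues 2 and 3 of [n] both make
     this product 2 modulo 4. *)
  rewrite Gauss_dvdr // /dvdn -modnMm => /eqP.
  have : n.-1 %% 4 = (n %% 4 + 3) %% 4 by lia.
  move=> ->; case: (n %% 4) (ltn_pmod n (isT : 0 < 4)) => [|[|[|[|]]]] //; auto.
have n_div := divn_eq n 4; have [n0 | n1] := n_mod.
  (* Positivity of [n] makes [n %/ 4] nonzero here, so its predecessor is not truncated. *)
  have -> : n = (4 * (n %/ 4).-1).+4 by lia.
  exact: C3_Kn_decomposition_mod0.
have -> : n = (4 * (n %/ 4)).+1 by lia.
exact: C3_Kn_decomposition_mod1.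
Qed.
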